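(* Let $\mathbf X$ be a recursive ML model on a DAG $\mathcal D=(V,E)$, $V=\{1,\dots,d\}$, with weights $c_{ki}>0$ for $i\in V$ and $k\in \mathrm{pa}(i)\cup\{i\}$. Define the $d\times d$ matrices $$A:=\mathrm{diag}(c_{11},\dots,c_{dd}),\quad A_0:=\big(c_{ij}\mathbf 1_{\mathrm{pa}(j)}(i)\big)_{d\times d},\quad A_1:=\big(c_{ii}c_{ij}\mathbf 1_{\mathrm{pa}(j)}(i)\big)_{d\times d}.$$ Then the ML coefficient matrix $B$ of $\mathbf X$ has the representation $$B=A\ \text{ for } d=1,\qquad B=A\vee\bigvee_{k=0}^{d-2}\big(A_1\odot A_0^{\odot k}\big)\ \text{ for } d\ge 2.$$
   Context: Let $\mathcal D=(V,E)$ be a directed acyclic graph (DAG) with $V=\{1,\dots,d\}$; write $k\to i$ if $(k,i)\in E$. For $i\in V$, $\mathrm{pa}(i)=\{k:(k,i)\in E\}$ are the parents of $i$ and $\mathrm{an}(i)$ is the set of ancestors of $i$ (nodes $j$ with a directed path of length at least one from $j$ to $i$). $P_{ji}$ is the set of directed paths from $j$ to $i$. A recursive max-linear (ML) model on $\mathcal D$ is a random vector $\mathbf X=(X_1,\dots,X_d)$ defined recursively by $X_i=\bigvee_{k\in \mathrm{pa}(i)} c_{ki}X_k\vee c_{ii}Z_i$, $i=1,\dots,d$, with independent non-negative random variables $Z_1,\dots,Z_d$ and positive weights $c_{ki}$, $k\in\mathrm{pa}(i)\cup\{i\}$. The weight of a path $p=[j=k_0\to k_1\to\dots\to k_n=i]$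 is $d_{ji}(p)=c_{k_0,k_0}\prod_{l=0}^{n-1}c_{k_l,k_{l+1}}$. The ML coefficient matrix $B=(b_{ij})_{d\times d}$ of $\mathbf X$ is given, for $i\in V$, by $b_{ji}=\bigvee_{p\in P_{ji}}d_{ji}(p)$ for $j\in\mathrm{an}(i)$, $b_{ii}=c_{ii}$, and $b_{ji}=0$ for $j\in V\setminus(\mathrm{an}(i)\cup\{i\})$. $\mathbf 1_{U}$ is the indicator function of a set $U$ ($\mathbf 1_\emptyset\equiv 0$); entries $c_{ij}\mathbf 1_{\mathrm{pa}(j)}(i)$ are $0$ when $i\notin\mathrm{pa}(j)$. For non-negative matrices $F=(f_{ij})_{m\times n}$, $G=(g_{ij})_{n\times p}$ the max-times product is $F\odot G:=\big(\bigvee_{k=1}^n f_{ik}g_{kj}\big)_{m\times p}$; powers of a $d\times d$ matrix are $A^{\odot 0}=\mathrm{id}_{d\times d}$ (identity matrix), $A^{\odot n}=A^{\odot(n-1)}\odot A$. For matrices of equal size, $\vee$ is the componentwise maximum. *)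

(* Defs.v *)
From HB Require Import structures.
From mathcomp Require Export all_boot all_order all_algebra.
From mathcomp Require Export all_classical all_reals all_analysis.
Set Implicit Arguments.
Unset Strict Implicit.
Unset Printing Implicit Defensive.
Import Order.TTheory GRing.Theory Num.Theory.
Local Open Scope classical_set_scope.
Local Open Scope ring_scope.

(* Conventions: the vertex set {1, ..., d} is 'I_d; [e k i] means k -> i. All
   maxima below are over non-negative numbers, so 0 is a neutral default for
   them. Only the entries [c k i] with k in pa(i) or k = i are weights; the
   other entries of the matrix [c] are arbitrary and never matter. *)

Section Graph.
Context (d : nat) (e : rel 'I_d).

Definition pa (i : 'I_d) : {set 'I_d} := finset (fun k => e k i).

(* The path [j = k_0 -> k_1 -> ... -> k_n = i] is encoded by its start j and
   the sequence [:: k_1; ...; k_n], whose size is therefore its length. *)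
Definition dipaths (j i : 'I_d) : set (seq 'I_d) :=
  [set p | path e j p /\ last j p = i].

Definition ancestor (j i : 'I_d) : Prop :=
  exists2 p, dipaths j i p & (0 < size p)%N.

Definition acyclic : Prop := forall i, ~ ancestor i i.

End Graph.

Section MaxTimes.
Context (R : realType).

Definition mxmax m n (F G : 'M[R]_(m, n)) : 'M[R]_(m, n) :=
  map2_mx Num.max F G.

Definition maxtimes m n p (F : 'M[R]_(m, n)) (G : 'M[R]_(n, p)) :
    'M[R]_(m, p) :=
  \matrix_(i, j) \big[Num.max/0]_(k < n) (F i k * G k j).

Fixpoint maxpow n (F : 'M[R]_n) (k : nat) : 'M[R]_n :=
  if k is k'.+1 then maxtimes (maxpow F k') F else 1%:M.

End MaxTimes.

Section MLmatrices.
Context (R : realType) (d : nat) (e : rel 'I_d) (c : 'M[R]_d).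

Definition positive_weights : Prop :=
  forall i k, k \in i |: pa e i -> 0 < c k i.

Definition path_weight (j : 'I_d) (p : seq 'I_d) : R :=
  c j j * \prod_(l < size p) c (nth j (j :: p) l) (nth j (j :: p) l.+1).

(* For an acyclic [e], dipaths is a finite set, non-empty when j is an
   ancestor of i, so the supremum is a maximum. *)
Definition ml_coef : 'M[R]_d :=
  \matrix_(j, i)
    if `[< ancestor e j i >] then sup (path_weight j @` dipaths e j i)
    else if j == i then c i i else 0.

Definition mxA : 'M[R]_d := diag_mx (\row_i c i i).

Definition mxA0 : 'M[R]_d := \matrix_(i, j) (c i j * (i \in pa e j)%:R).

Definition mxA1 : 'M[R]_d :=
  \matrix_(i, j) (c i i * c i j * (i \in pa e j)%:R).

End MLmatrices.

Section Model.
Context (R : realType) (dT : measure_display) (T : measurableType dT).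
Context (P : probability T R) (d : nat).

Definition mutually_independent (Z : 'I_d -> {RV P >-> R}) : Prop :=
  forall (J : {set 'I_d}) (S : 'I_d -> set R),
    (forall i, measurable (S i)) ->
    P (\bigcap_(i in [set` J]) (Z i @^-1` S i)) =
    (\prod_(i in J) P (Z i @^-1` S i))%E.

Record recursive_ML_model (e : rel 'I_d) (c : 'M[R]_d)
    (Z X : 'I_d -> {RV P >-> R}) : Prop := {
  ml_innov_ge0 : forall i t, 0 <= Z i t ;
  ml_innov_indep : mutually_independent Z ;
  ml_recursion : forall i t,
    X i t = Num.max (\big[Num.max/0]_(k in pa e i) (c k i * X k t))
                    (c i i * Z i t)
}.

End Model.

(* Main.v *)
Require Import Defs.
From mathcomp Require Import all_boot all_order all_algebra.
From mathcomp Require Import all_classical all_reals all_analysis.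
Set Implicit Arguments.
Unset Strict Implicit.
Unset Printing Implicit Defensive.
Import Order.TTheory GRing.Theory Num.Theory.
Local Open Scope ring_scope.

(** In max-times algebra, as in ordinary linear algebra, the (j, i) entry of
    the k-th power of the weighted adjacency matrix [mxA0] aggregates the
    walks of length k from j to i: here it is the largest product of edge
    weights along such a walk, or 0 if there is none ([maxpow_walk]). The
    reason is that walks of length m + n are exactly the concatenations of
    walks of lengths m and n, and products of non-negative numbers are
    monotone, so the best concatenation through a fixed middle vertex is the
    concatenation of the best halves ([maxtimes_walk]).

    Multiplying on the left by [mxA1], whose row j is c_jj times that of
    [mxA0], adds one edge and the weight c_jj of the starting vertex. The k-th
    term of the maximum is thus the largest weight of a path of length k + 1.
    In an acyclic graph no path visits a vertex twice ([acyclic_path_uniq]), so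
    all paths have length at most d - 1 and the lengths 1, ..., d - 1 account
    for every path between distinct vertices. Paths from a vertex to itself of
    positive length do not exist, and the matrix [mxA] supplies the diagonal.

    The bookkeeping rests on the relation [is_max0 S m], which says that m is
    the maximum of the non-negative set S together with 0. Adjoining 0 makes
    the relation meaningful for an empty set of walks, and makes it compatible
    with products and with maxima that start from 0. *)

(** * Maxima of sets of non-negative numbers *)

Section Max0.
Context (R : realType).
Local Open Scope classical_set_scope.

Definition is_max0 (S : set R) (m : R) : Prop :=
  (0 |` S) m /\ forall x, (0 |` S) x -> 0 <= x <= m.

Lemma is_max0_ge0 S m : is_max0 S m -> 0 <= m.
Proof. by case=> m0S /(_ m m0S)/andP[]. Qed.

Lemma is_max0_ub S m x : is_max0 S m -> S x -> x <= m.
Proof. by case=> _ Sm Sx; have /andP[] := Sm x (or_intror Sx). Qed.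

Lemma is_max0_empty S m : is_max0 S m -> (forall x, ~ S x) -> m = 0.
Proof. by case=> [[//|Sm] _] /(_ m). Qed.

(** One positive element is enough to rule out the adjoined 0. *)
Lemma is_max0_in S m x : is_max0 S m -> S x -> 0 < x -> S m.
Proof.
move=> maxm Sx x_gt0; have xm := is_max0_ub maxm Sx.
by case: maxm => [[m0|//] _]; move: xm; rewrite m0 leNgt x_gt0.
Qed.

Lemma is_max0_if (b : bool) (a : R) :
  (b -> 0 <= a) -> is_max0 [set x | b /\ x = a] (a * b%:R).
Proof.
case: b => [/(_ isT) a_ge0|_]; rewrite ?mulr1 ?mulr0.
  by split=> [|x [->|[_ ->]]]; [right | rewrite lexx | rewrite a_ge0 lexx].
by split=> [|x [->|[]//]]; [left | rewrite lexx].
Qed.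

Lemma is_max0_mul S T m n : is_max0 S m -> is_max0 T n ->
  is_max0 [set x * y | x in S & y in T] (m * n).
Proof.
move=> [m0S mS] [n0T nT].
have [m_ge0 n_ge0] := (is_max0_ge0 (conj m0S mS), is_max0_ge0 (conj n0T nT)).
split.
  case: m0S => [->|Sm]; first by left; rewrite mul0r.
  case: n0T => [->|Tn]; first by left; rewrite mulr0.
  by right; exists m => //; exists n.
move=> _ [->|[x Sx [y Ty <-]]]; first by rewrite lexx mulr_ge0.
have /andP[x_ge0 xm] := mS x (or_intror Sx).
have /andP[y_ge0 yn] := nT y (or_intror Ty).
by rewrite mulr_ge0 /= ?ler_pM.
Qed.

Lemma is_max0_bigmax (I : eqType) (r : seq I) (S : I -> set R) (m : I -> R) :
  (forall k, is_max0 (S k) (m k)) ->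
  is_max0 [set x | exists2 k, k \in r & S k x] (\big[Num.max/0]_(k <- r) m k).
Proof.
move=> maxS; elim: r => [|k r [IHin IHub]].
  by rewrite big_nil; split=> [|x [->|[]//]]; [left | rewrite lexx].
have [m0S mS] := maxS k; rewrite big_cons; split.
  case: leP => _.
    case: IHin => [->|[l lr Sl]]; first by left.
    by right; exists l => //; rewrite inE lr orbT.
  case: m0S => [->|Sm]; first by left.
  by right; exists k; rewrite ?mem_head.
move=> x Sx; rewrite le_max.
have [Skx|tSx] : (0 |` S k) x \/
    (0 |` [set y | exists2 l, l \in r & S l y]) x.
- case: Sx => [->|[l]]; first by left; left.
  rewrite inE => /predU1P[->|lr] Slx; first by left; right.
  by right; right; exists l.
- by have /andP[-> ->] := mS x Skx.
- by have /andP[-> ->] := IHub x tSx; rewrite orbT.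
Qed.

End Max0.

(** * Walks and max-times powers *)

Section Walks.
Context (R : realType) (d : nat) (e : rel 'I_d) (c : 'M[R]_d).
Hypothesis c_gt0 : positive_weights e c.

(** The factor of [path_weight] contributed by the edges, by recursion on the
    path so that it can be split along a concatenation. *)
Fixpoint edge_prod (j : 'I_d) (p : seq 'I_d) : R :=
  if p is k :: p' then c j k * edge_prod k p' else 1.

Lemma path_weightE j p : path_weight c j p = c j j * edge_prod j p.
Proof.
rewrite /path_weight; congr (_ * _).
elim: p j => [|k p IHp] j; first by rewrite big_ord0.
rewrite big_ord_recl /= -IHp; congr (_ * _).
apply: eq_bigr => l _ /=.
(* the defaults j and k differ, but both indices are within bounds *)
congr (c _ _); apply: set_nth_default; last exact: ltn_ord.
exact: leqW (ltn_ord l).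
Qed.

Lemma edge_prod_cat j p q :
  edge_prod j (p ++ q) = edge_prod j p * edge_prod (last j p) q.
Proof.
by elim: p j => [|k p IHp] j /=; rewrite ?mul1r // IHp mulrA.
Qed.

Lemma edge_weight_gt0 j i : e j i -> 0 < c j i.
Proof. by move=> ji; apply: c_gt0; rewrite !inE ji orbT. Qed.

Lemma vertex_weight_gt0 i : 0 < c i i.
Proof. by apply: c_gt0; rewrite setU11. Qed.

Lemma edge_prod_gt0 j p : path e j p -> 0 < edge_prod j p.
Proof.
elim: p j => //= k p IHp j /andP[jk kp].
by rewrite mulr_gt0 ?edge_weight_gt0 ?IHp.
Qed.

Definition walk_weights (n : nat) (j i : 'I_d) : set R :=
  [set x | exists2 p, dipaths e j i p & size p = n /\ x = edge_prod j p].

Lemma walk_weights0 j i :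
  walk_weights 0 j i = [set x | j == i /\ x = 1]%classic.
Proof.
apply/seteqP; split=> x /=.
  by case=> p [_ pi] [/size0nil p0 ->]; rewrite p0 /= in pi *; rewrite pi eqxx.
by case=> /eqP ji ->; exists [::].
Qed.

Lemma walk_weights1 j i :
  walk_weights 1 j i = [set x | e j i /\ x = c j i]%classic.
Proof.
apply/seteqP; split=> x /=.
  case=> -[|k [|l p]] [/= jp <-] [] // _ ->.
  by move: jp => /andP[jk _]; rewrite mulr1.
by case=> ji ->; exists [:: i]; rewrite /= ?mulr1 //; split=> //=; rewrite ji.
Qed.

(** Cutting a walk of length m + n after m steps. *)
Lemma walk_weightsD m n j i :
  walk_weights (m + n) j i =
  [set x | exists2 k, k \in index_enum 'I_d &
     [set x * y | x in walk_weights m j k & y in walk_weights n k i] x]%classic.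
Proof.
apply/seteqP; split=> x /=.
  case=> p [jp pi] [szp ->]; rewrite -(cat_take_drop m p) in jp pi *.
  have szt : size (take m p) = m by rewrite size_takel // szp leq_addr.
  rewrite cat_path in jp; case/andP: jp => jt td; rewrite last_cat in pi.
  exists (last j (take m p)); first exact: mem_index_enum.
  rewrite edge_prod_cat; exists (edge_prod j (take m p)).
    by exists (take m p).
  exists (edge_prod (last j (take m p)) (drop m p)) => //.
  by exists (drop m p) => //; rewrite size_drop szp addKn.
case=> k _ [_ [p [jp pk] [<- ->]] [_ [q [kq qi] [<- ->]] <-]].
exists (p ++ q); last by rewrite size_cat edge_prod_cat pk.
by split; rewrite ?cat_path ?last_cat pk // jp.
Qed.

(** The max-times product chooses the best middle vertex and, for it, the best
    two halves. *)
Lemma maxtimes_walk m n (F G : 'M[R]_d) :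
  (forall j i, is_max0 (walk_weights m j i) (F j i)) ->
  (forall j i, is_max0 (walk_weights n j i) (G j i)) ->
  forall j i, is_max0 (walk_weights (m + n) j i) (maxtimes F G j i).
Proof.
move=> maxF maxG j i; rewrite mxE walk_weightsD.
by apply: is_max0_bigmax => k; apply: is_max0_mul.
Qed.

Lemma mxA0_walk j i : is_max0 (walk_weights 1 j i) (mxA0 e c j i).
Proof.
rewrite walk_weights1 mxE inE; apply: is_max0_if => ji.
exact/ltW/edge_weight_gt0.
Qed.

Lemma maxpow_walk k j i :
  is_max0 (walk_weights k j i) (maxpow (mxA0 e c) k j i).
Proof.
elim: k j i => [|k IHk] j i /=; last first.
  by rewrite -addn1; apply: maxtimes_walk mxA0_walk _ _.
rewrite walk_weights0 mxE -mulr_natr mul1r -[_%:R]mul1r.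
by apply: is_max0_if => _; apply: ler01.
Qed.

Lemma maxtimes_mxA1 (F : 'M[R]_d) j i :
  maxtimes (mxA1 e c) F j i = c j j * maxtimes (mxA0 e c) F j i.
Proof.
have cjj_ge0 := ltW (vertex_weight_gt0 j).
rewrite !mxE (big_morph ( *%R (c j j)) (fun x y => maxr_pMr x y cjj_ge0)
  (mulr0 _)).
by apply: eq_bigr => k _; rewrite !mxE !mulrA.
Qed.

End Walks.

(** * Paths in acyclic graphs *)

(** The segment between two visits of the same vertex would be a cycle. *)
Lemma acyclic_path_uniq d (e : rel 'I_d) j p :
  acyclic e -> path e j p -> uniq (j :: p).
Proof.
move=> acyclic_e; elim: p j => //= k p IHp j /andP[jk kp].
rewrite (IHp _ kp) andbT; apply/negP => j_kp.
have : path e j (k :: p) by rewrite /= jk.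
case/path.splitP: j_kp => p1 p2; rewrite cat_path => /andP[jp1 _].
apply: (acyclic_e j); exists (rcons p1 j); last by rewrite size_rcons.
by split; rewrite ?last_rcons.
Qed.

Lemma acyclic_path_size d (e : rel 'I_d) j p :
  acyclic e -> path e j p -> (size p < d)%N.
Proof.
move=> acyclic_e /(acyclic_path_uniq acyclic_e)/card_uniqP jp.
by have := max_card (mem (j :: p)); rewrite jp card_ord.
Qed.

(** * The representation of the max-linear coefficient matrix *)

Lemma mxmax_bigE (R : realType) m n (I : Type) (r : seq I)
    (F : I -> 'M[R]_(m, n)) j i :
  (\big[@mxmax R m n/0]_(k <- r) F k) j i = \big[Num.max/0]_(k <- r) F k j i.
Proof.
by apply: (big_morph (fun M : 'M[R]_(m, n) => M j i)) => [M N|]; rewrite !mxE.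
Qed.

Section Representation.
Context (R : realType) (d : nat) (e : rel 'I_d) (c : 'M[R]_d).
Hypothesis acyclic_e : acyclic e.
Hypothesis c_gt0 : positive_weights e c.

Lemma ml_coef_diag i : ml_coef e c i i = c i i.
Proof.
by rewrite mxE eqxx; case: asboolP => // /acyclic_e.
Qed.

(** The terms of the maximum, stripped of the weight of the starting vertex,
    range over all lengths that a path of positive length can have. *)
Lemma bigmax_walk j i :
  is_max0 [set x | exists2 p, dipaths e j i p &
                     (0 < size p)%N /\ x = edge_prod c j p]
    (\big[Num.max/0]_(0 <= k < d.-1)
       maxtimes (mxA0 e c) (maxpow (mxA0 e c) k) j i).
Proof.
have := is_max0_bigmax (index_iota 0 d.-1) (fun k =>
  maxtimes_walk (mxA0_walk c_gt0) (maxpow_walk c_gt0 k) j i).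
congr is_max0; apply/seteqP; split=> x /=.
  by case=> k _ [p jpi [szp ->]]; exists p; rewrite ?szp.
case=> p jpi [p_gt0 ->]; have [jp _] := jpi.
exists (size p).-1; last by exists p; rewrite // add1n prednK.
rewrite mem_index_iota /= -ltnS prednK //.
have size_lt := acyclic_path_size acyclic_e jp.
by rewrite (ltn_predK size_lt).
Qed.

Lemma ml_coefE :
  ml_coef e c =
  mxmax (mxA c)
    (\big[@mxmax R d d/0]_(0 <= k < d.-1)
       maxtimes (mxA1 e c) (maxpow (mxA0 e c) k)).
Proof.
apply/matrixP => j i; rewrite [RHS]mxE mxmax_bigE.
have cjj_gt0 := vertex_weight_gt0 c_gt0 j.
under eq_bigr do rewrite maxtimes_mxA1 //.
rewrite -(big_morph ( *%R (c j j))
  (fun x y => maxr_pMr x y (ltW cjj_gt0)) (mulr0 _)).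
move: (bigmax_walk j i); move: (\big[_/_]_(_ <= _ < _) _) => m maxm.
have m_ge0 := is_max0_ge0 maxm.
have notanc : ~ ancestor e j i -> m = 0.
  move=> noanc; apply: is_max0_empty maxm _ => x [p jpi [p_gt0 _]].
  by apply: noanc; exists p.
case: (eqVneq j i) maxm notanc => [<-|ji] maxm notanc.
  rewrite ml_coef_diag notanc ?mulr0 ?mxE ?eqxx ?mulr1n; last exact: acyclic_e.
  by rewrite max_l // ltW.
rewrite !mxE (negPf ji) mulr0n max_r; last by rewrite mulr_ge0 // ltW.
case: asboolP => [[p jpi p_gt0]|/notanc->]; last by rewrite mulr0.
have [q jqi [q_gt0 mE]] : [set x | exists2 p, dipaths e j i p &
    (0 < size p)%N /\ x = edge_prod c j p]%classic m.
  apply: (is_max0_in maxm); first by exists p.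
  by apply: (edge_prod_gt0 c_gt0); case: jpi.
have ubm : ubound (path_weight c j @` dipaths e j i)%classic (c j j * m).
  move=> _ [r jri <-]; rewrite path_weightE ler_pM2l //.
  apply: (is_max0_ub maxm); exists r => //; split=> //.
  (* the empty path would end at j, which differs from i *)
  by case: r jri => // -[_ /= jE]; rewrite jE eqxx in ji.
have inm : (path_weight c j @` dipaths e j i)%classic (c j j * m).
  by exists q; rewrite // path_weightE mE.
apply/eqP; rewrite eq_le; apply/andP; split.
  by apply: ge_sup => //; exists (c j j * m).
by apply: ub_le_sup => //; exists (c j j * m).
Qed.

End Representation.

Theorem theorem2p4 (R : realType) (dT : measure_display)
    (T : measurableType dT) (P : probability T R)
    (d : nat) (e : rel 'I_d) (c : 'M[R]_d) (Z X : 'I_d -> {RV P >-> R})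
    (acyclic_e : acyclic e) (c_gt0 : positive_weights e c)
    (ML_X : recursive_ML_model e c Z X) :
  (d = 1%N -> ml_coef e c = mxA c) /\
  ((2 <= d)%N ->
     ml_coef e c =
     mxmax (mxA c)
       (\big[@mxmax R d d/0]_(0 <= k < d.-1)
          maxtimes (mxA1 e c) (maxpow (mxA0 e c) k))).
Proof.
split=> [d1|_]; last exact: ml_coefE.
apply/matrixP => j i; subst d.
by rewrite !ord1 ml_coef_diag // !mxE eqxx mulr1n.
Qed.
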